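(* Let $n\ge2$. Every element of the t-BMW algebra $\mathcal{K}_n$ can be reduced, i.e. it can be written as a $\mathbb{K}$-linear combination of words in the defining generators each of which has at most one element of $$\Gamma_n=\{1,\ g_{n-1},\ g_{n-1}e_{n-1},\ h_{n-1},\ e_{n-1},\ f_{n-1}\}$$ (i.e. words of the form $w'\,d\,w''$ with $d\in\Gamma_n$ and $w',w''$ words in the defining generators of index at most $n-2$). Thus $\mathcal{K}_n$ is finite dimensional over $\mathbb{K}$.
   Context: Let $\mathbb{K}=\mathbb{C}(x,z,a)$ with $x,z,a$ independent commuting variables. The t-BMW algebra $\mathcal{K}_n=\mathcal{K}_n(x,z,a)$ is the associative unital $\mathbb{K}$-algebra equal to $\mathbb{K}$ for $n=1$ and, for $n>1$, generated by invertible elements $g_1,\dots,g_{n-1}$ and elements $h_i,e_i,f_i$ ($1\le i\le n-1$) subject to the following relations. For $|i-j|>1$: $g_ig_j=g_jg_i$, $h_ih_j=h_jh_i$, $g_ih_j=h_jg_i$, $e_ig_j=g_je_i$, $e_ih_j=h_je_i$. For all $i,j$: $e_ie_j=e_je_i$. For all $i$: $h_i^2=x^{-1}h_i$; $g_ih_i=h_ig_i=a^{-1}h_i$; $e_i^2=e_i$; $e_ig_i=g_ie_i$; $e_ih_i=h_ie_i=h_i$; $f_ie_i=e_if_i=f_i$; $f_ig_i=g_if_i=a^{-1}f_i$; $g_i+g_i^{-1}=z(e_i+f_i)$. For $|i-j|=1$: $g_ig_jg_i=g_jg_ig_j$; $h_ig_jh_i=ah_i$; $h_ih_jh_i=h_i$;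 $g_ig_jh_i=h_jg_ig_j=h_jh_i$; $g_ih_jg_i=g_j^{-1}h_ig_j^{-1}$; $g_ih_jh_i=g_j^{-1}h_i$; $h_ih_jg_i=h_ig_j^{-1}$; $e_ie_jg_i=g_ie_ie_j=e_jg_ie_j$; $e_ig_jg_i=g_jg_ie_j$; $f_ie_j=e_jf_i=e_jh_ie_j$; $g_if_jg_i=g_j^{-1}f_ig_j^{-1}$. *)

(* Defs.v *)
From HB Require Import structures.
From mathcomp Require Import all_boot all_order all_algebra.
From mathcomp Require Import generic_quotient ring_quotient complex fraction.
From mathcomp Require Import boolp reals.
From mathcomp Require Import mpoly monalg.

Set Implicit Arguments.
Unset Strict Implicit.
Unset Printing Implicit Defensive.

Import GRing.Theory.

Local Open Scope ring_scope.
Local Open Scope quotient_scope.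

(* An alias of seq, made a monomType with concatenation as product, so that
   {malg K[word T]} is the free K-algebra on T. *)
Definition word (T : Type) : Type := seq T.

HB.instance Definition _ (T : choiceType) := Choice.on (word T).

Lemma word_unit (T : Type) (v w : word T) : v ++ w = [::] -> v = [::] /\ w = [::].
Proof. by case: v => // -> . Qed.

HB.instance Definition _ (T : choiceType) :=
  Choice_isMonomialDef.Build (word T)
    (@catA T) (@cat0s T) (@cats0 T) (@word_unit T).

(* [presented rels] is the K-algebra with generators T and relations u = v for
   rels u v: the quotient of the free algebra by the two-sided ideal generated
   by the differences u - v. *)
Section Presentation.

Variables (K : fieldType) (T : choiceType).

Notation freealg := {malg K[word T]}.

Definition free_gen (t : T) : freealg := mkmalgU ([:: t] : word T) 1.

Variable rels : freealg -> freealg -> Prop.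

Inductive rel_ideal : freealg -> Prop :=
| rel_ideal_gen u v of rels u v : rel_ideal (u - v)
| rel_ideal0 : rel_ideal 0
| rel_idealD u v of rel_ideal u & rel_ideal v : rel_ideal (u + v)
| rel_idealMl w u of rel_ideal u : rel_ideal (w * u)
| rel_idealMr w u of rel_ideal u : rel_ideal (u * w).

Definition rel_ideal_pred : pred freealg := fun u => `[< rel_ideal u >].

Lemma rel_ideal_zmod_closed : zmod_closed rel_ideal_pred.
Proof.
split=> [|u v]; first exact/asboolP/rel_ideal0.
move=> /asboolP Iu /asboolP Iv; apply/asboolP/rel_idealD => //.
by rewrite -mulN1r; apply: rel_idealMl.
Qed.

HB.instance Definition _ :=
  GRing.isZmodClosed.Build freealg rel_ideal_pred rel_ideal_zmod_closed.

Definition rel_ideal_closed : zmodClosed freealg :=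
  GRing.ZmodClosed.clone freealg rel_ideal_pred _.

Definition presented : Type := Quotient.quot rel_ideal_closed.

HB.instance Definition _ := GRing.Zmodule.on presented.

Definition pres_pi (u : freealg) : presented := \pi_(Quotient.quot rel_ideal_closed) u.
Definition pres_repr (p : presented) : freealg := @repr _ (Quotient.quot rel_ideal_closed) p.

Lemma pres_reprK : cancel pres_repr pres_pi. Proof. exact: reprK. Qed.

Lemma pres_piP u v : pres_pi u = pres_pi v <-> rel_ideal (u - v).
Proof.
have E := Quotient.idealrBE rel_ideal_closed u v.
by split=> [/eqP|/asboolP Iuv]; [rewrite -E => /asboolP | apply/eqP; rewrite -E].
Qed.

Lemma pres_piD : {morph pres_pi : u v / u + v}.
Proof. exact: Quotient.pi_add. Qed.

Lemma pres_pi0 : pres_pi 0 = 0.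
Proof. by apply: (addrI (pres_pi 0)); rewrite -pres_piD !addr0. Qed.

Lemma pres_pi_repr u : rel_ideal (pres_repr (pres_pi u) - u).
Proof. by apply/pres_piP; rewrite pres_reprK. Qed.

Definition pmul (p q : presented) : presented := pres_pi (pres_repr p * pres_repr q).
Definition pscale (c : K) (p : presented) : presented := pres_pi (c *: pres_repr p).

Lemma pres_piM u v : pres_pi (u * v) = pmul (pres_pi u) (pres_pi v).
Proof.
apply/esym/pres_piP; set u' := pres_repr _; set v' := pres_repr _.
have -> : u' * v' - u * v = (u' - u) * v' + u * (v' - v).
  by rewrite mulrBl mulrBr addrA subrK.
by apply: rel_idealD; [apply: rel_idealMr | apply: rel_idealMl]; apply: pres_pi_repr.
Qed.

Lemma pres_piZ c u : pres_pi (c *: u) = pscale c (pres_pi u).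
Proof.
apply/esym/pres_piP; rewrite -scalerBr -mul_malgC.
by apply: rel_idealMl; apply: pres_pi_repr.
Qed.

Lemma pres_piW (P : presented -> Prop) : (forall u, P (pres_pi u)) -> forall p, P p.
Proof. by move=> PP p; rewrite -[p]pres_reprK. Qed.

Lemma pmulA : associative pmul.
Proof.
by elim/pres_piW=> u; elim/pres_piW=> v; elim/pres_piW=> w; rewrite -!pres_piM mulrA.
Qed.

Lemma pmul1 : left_id (pres_pi 1) pmul.
Proof. by elim/pres_piW=> u; rewrite -pres_piM mul1r. Qed.

Lemma pmulr1 : right_id (pres_pi 1) pmul.
Proof. by elim/pres_piW=> u; rewrite -pres_piM mulr1. Qed.

Lemma pmulDl : left_distributive pmul +%R.
Proof.
by elim/pres_piW=> u; elim/pres_piW=> v; elim/pres_piW=> w;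
  rewrite -!(pres_piM, pres_piD) mulrDl.
Qed.

Lemma pmulDr : right_distributive pmul +%R.
Proof.
by elim/pres_piW=> u; elim/pres_piW=> v; elim/pres_piW=> w;
  rewrite -!(pres_piM, pres_piD) mulrDr.
Qed.

HB.instance Definition _ :=
  GRing.Zmodule_isPzRing.Build presented pmulA pmul1 pmulr1 pmulDl pmulDr.

Lemma pscaleA c d p : pscale c (pscale d p) = pscale (c * d) p.
Proof. by elim/pres_piW: p => u; rewrite -!pres_piZ scalerA. Qed.

Lemma pscale1 : left_id 1 pscale.
Proof. by elim/pres_piW=> u; rewrite -pres_piZ scale1r. Qed.

Lemma pscaleDr : right_distributive pscale +%R.
Proof.
by move=> c; elim/pres_piW=> u; elim/pres_piW=> v;
  rewrite -!(pres_piZ, pres_piD) scalerDr.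
Qed.

Lemma pscaleDl p : {morph pscale^~ p : c d / c + d}.
Proof. by elim/pres_piW: p => u c d /=; rewrite -!(pres_piZ, pres_piD) scalerDl. Qed.

HB.instance Definition _ :=
  GRing.Zmodule_isLmodule.Build K presented pscaleA pscale1 pscaleDr pscaleDl.

Lemma pscaleAl (c : K) (p q : presented) : c *: (p * q) = (c *: p) * q.
Proof.
by elim/pres_piW: p => u; elim/pres_piW: q => v;
  rewrite -[_ * _]pres_piM -[c *: _]pres_piZ scalerAl pres_piM pres_piZ.
Qed.

Lemma malgC_comm (c : K) (u : freealg) : malgC c * u = u * malgC c.
Proof.
rewrite !malgM_def fgmulUg fgmulgU; apply: eq_bigr => w _.
by rewrite mulrC monalg.mul1m monalg.mulm1.
Qed.

Lemma pscaleAr (c : K) (p q : presented) : c *: (p * q) = p * (c *: q).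
Proof.
elim/pres_piW: p => u; elim/pres_piW: q => v.
rewrite -[_ * pres_pi v]pres_piM -[c *: _]pres_piZ -[c *: pres_pi v]pres_piZ.
by rewrite -[RHS]pres_piM -!mul_malgC !mulrA malgC_comm.
Qed.

End Presentation.

(* [kGinv] names the inverses of the invertible generators [kG]. *)
Variant kind := kG | kGinv | kH | kE | kF.

Definition kind_code (k : kind) : nat :=
  match k with kG => 0 | kGinv => 1 | kH => 2 | kE => 3 | kF => 4 end.
Definition kind_decode (m : nat) : kind :=
  match m with 0 => kG | 1 => kGinv | 2 => kH | 3 => kE | _ => kF end.
Lemma kind_codeK : cancel kind_code kind_decode. Proof. by case. Qed.
HB.instance Definition _ := Countable.copy kind (can_type kind_codeK).

(* Indices are shifted by one: the generators of index 1, ..., n - 1 are those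
   of value 0, ..., n - 2 in 'I_n.-1. *)
Definition letter (n : nat) : Type := (kind * 'I_n.-1)%type.
HB.instance Definition _ n := Choice.on (letter n).

Section Relations.

Variables (K : fieldType) (x z a : K) (n : nat).

Definition far (i j : 'I_n.-1) : bool := (i.+1 < j)%N || (j.+1 < i)%N.
Definition adj (i j : 'I_n.-1) : bool := (i.+1 == j)%N || (j.+1 == i)%N.

Section Families.

(* [g' i] stands for the inverse of [g i]. *)
Variables (A : lalgType K) (g g' h e f : 'I_n.-1 -> A).

Inductive tBMW_rel : A -> A -> Prop :=
| far_gg i j of far i j : tBMW_rel (g i * g j) (g j * g i)
| far_hh i j of far i j : tBMW_rel (h i * h j) (h j * h i)
| far_gh i j of far i j : tBMW_rel (g i * h j) (h j * g i)
| far_eg i j of far i j : tBMW_rel (e i * g j) (g j * e i)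
| far_eh i j of far i j : tBMW_rel (e i * h j) (h j * e i)
| all_ee i j : tBMW_rel (e i * e j) (e j * e i)
| one_ggV i : tBMW_rel (g i * g' i) 1
| one_gVg i : tBMW_rel (g' i * g i) 1
| one_hh i : tBMW_rel (h i * h i) (x^-1 *: h i)
| one_gh i : tBMW_rel (g i * h i) (a^-1 *: h i)
| one_hg i : tBMW_rel (h i * g i) (a^-1 *: h i)
| one_ee i : tBMW_rel (e i * e i) (e i)
| one_eg i : tBMW_rel (e i * g i) (g i * e i)
| one_eh i : tBMW_rel (e i * h i) (h i)
| one_he i : tBMW_rel (h i * e i) (h i)
| one_fe i : tBMW_rel (f i * e i) (f i)
| one_ef i : tBMW_rel (e i * f i) (f i)
| one_fg i : tBMW_rel (f i * g i) (a^-1 *: f i)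
| one_gf i : tBMW_rel (g i * f i) (a^-1 *: f i)
| one_skein i : tBMW_rel (g i + g' i) (z *: (e i + f i))
| adj_ggg i j of adj i j : tBMW_rel (g i * g j * g i) (g j * g i * g j)
| adj_hgh i j of adj i j : tBMW_rel (h i * g j * h i) (a *: h i)
| adj_hhh i j of adj i j : tBMW_rel (h i * h j * h i) (h i)
| adj_ggh i j of adj i j : tBMW_rel (g i * g j * h i) (h j * g i * g j)
| adj_hgg i j of adj i j : tBMW_rel (h j * g i * g j) (h j * h i)
| adj_ghg i j of adj i j : tBMW_rel (g i * h j * g i) (g' j * h i * g' j)
| adj_ghh i j of adj i j : tBMW_rel (g i * h j * h i) (g' j * h i)
| adj_hhg i j of adj i j : tBMW_rel (h i * h j * g i) (h i * g' j)
| adj_eeg i j of adj i j : tBMW_rel (e i * e j * g i) (g i * e i * e j)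
| adj_gee i j of adj i j : tBMW_rel (g i * e i * e j) (e j * g i * e j)
| adj_egg i j of adj i j : tBMW_rel (e i * g j * g i) (g j * g i * e j)
| adj_fe i j of adj i j : tBMW_rel (f i * e j) (e j * f i)
| adj_ef i j of adj i j : tBMW_rel (e j * f i) (e j * h i * e j)
| adj_gfg i j of adj i j : tBMW_rel (g i * f j * g i) (g' j * f i * g' j).

Lemma tBMW_rel_eval (phi : A -> K) I :
    I * I = - 1 ->
    phi 1 = 1 -> (forall u v, phi (u + v) = phi u + phi v) ->
    (forall u v, phi (u * v) = phi u * phi v) ->
    (forall c u, phi (c *: u) = c * phi u) ->
    (forall i, phi (g i) = I) -> (forall i, phi (g' i) = - I) ->
    (forall i, phi (h i) = 0) -> (forall i, phi (e i) = 0) ->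
    (forall i, phi (f i) = 0) ->
  forall u v, tBMW_rel u v -> phi u = phi v.
Proof.
move=> II phi1 phiD phiM phiZ phig phig' phih phie phif u v [] *;
  rewrite ?(phiZ, phiD, phiM, phi1) ?(phig, phig', phih, phie, phif);
  by rewrite ?(mulrN, mulNr, II, mulr0, mul0r, addr0, oppr0, opprK, subrr).
Qed.

End Families.

Notation freealg := {malg K[word (letter n)]}.

Definition letterg (k : kind) (i : 'I_n.-1) : freealg := free_gen K (k, i).

Definition tBMW_relations : freealg -> freealg -> Prop :=
  tBMW_rel (letterg kG) (letterg kGinv) (letterg kH) (letterg kE) (letterg kF).

(* Non-triviality of the presented algebra over a field with a square root I of
   -1: it has the one-dimensional representation sending every g_i to I and all
   h_i, e_i, f_i to 0. *)
Variable I : K.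
Hypothesis I_sqr : I * I = - 1.

Definition letter_val (l : letter n) : K :=
  match l.1 with kG => I | kGinv => - I | _ => 0 end.

Definition word_val (w : word (letter n)) : K := \prod_(l <- w) letter_val l.

Lemma word_valM : mmorphism word_val.
Proof. by split=> [u v|]; rewrite /word_val ?big_cat ?big_nil. Qed.

HB.instance Definition _ := isMultiplicative.Build _ _ word_val word_valM.

Definition tBMW_val : freealg -> K := mmap idfun word_val.

HB.instance Definition _ := GRing.RMorphism.on tBMW_val.

Lemma tBMW_val_letter k i : tBMW_val (letterg k i) = letter_val (k, i).
Proof. by rewrite [LHS]mmapU mul1r /word_val /= big_seq1. Qed.

Lemma tBMW_val_ideal u : rel_ideal tBMW_relations u -> tBMW_val u = 0.
Proof.
elim=> {u} [u v uv||u v _ u0 _ v0|w u _ u0|w u _ u0].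
- rewrite rmorphB; apply/eqP; rewrite subr_eq0; apply/eqP.
  apply: (tBMW_rel_eval I_sqr _ _ _ _ _ _ _ _ _ uv) => [|? ?|? ?|? ?|i|i|i|i|i].
  + exact: rmorph1.
  + exact: rmorphD.
  + exact: rmorphM.
  + exact: mmapZ.
  + exact: (tBMW_val_letter kG).
  + exact: (tBMW_val_letter kGinv).
  + exact: (tBMW_val_letter kH).
  + exact: (tBMW_val_letter kE).
  + exact: (tBMW_val_letter kF).
- exact: rmorph0.
- by rewrite rmorphD /= u0 v0 addr0.
- by rewrite rmorphM /= u0 mulr0.
- by rewrite rmorphM /= u0 mul0r.
Qed.

Lemma tBMW_rel_oner_neq0 : (1 : presented tBMW_relations) != 0.
Proof.
apply/eqP; rewrite -(pres_pi0 tBMW_relations) => /pres_piP.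
by rewrite subr0 => /tBMW_val_ideal/eqP; rewrite rmorph1 oner_eq0.
Qed.

End Relations.

(* C(x,z,a): any R : realType is a model of the real numbers, so R[i] is C.  The
   notation {mpoly R[i][3]} is not used since monalg.v gives it another meaning. *)
Definition Kxza (R : realType) : fieldType := {fraction (mpoly 3 R[i])}.
Definition Kx (R : realType) : Kxza R := tofrac ('X_(inord 0) : mpoly 3 R[i]).
Definition Kz (R : realType) : Kxza R := tofrac ('X_(inord 1) : mpoly 3 R[i]).
Definition Ka (R : realType) : Kxza R := tofrac ('X_(inord 2) : mpoly 3 R[i]).

Lemma Kxza_sqrtN1 (R : realType) :
  let I := tofrac (mpolyC 3 ('i : R[i])%C) : Kxza R in I * I = - 1.
Proof.
rewrite /= -rmorphM -mpoly.mpolyCM -expr2 complex.sqr_i /=.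
by rewrite mpoly.mpolyCN mpoly.mpolyC1 rmorphN rmorph1.
Qed.

Definition tBMW (R : realType) (n : nat) : Type :=
  presented (@tBMW_relations (Kxza R) (Kx R) (Kz R) (Ka R) n).

Section Instances.

Variables (R : realType) (n : nat).

HB.instance Definition _ := GRing.PzRing.on (tBMW R n).
HB.instance Definition _ := GRing.Lmodule.on (tBMW R n).
HB.instance Definition _ := GRing.PzSemiRing_isNonZero.Build (tBMW R n)
  (tBMW_rel_oner_neq0 (Kx R) (Kz R) (Ka R) n (Kxza_sqrtN1 R)).
HB.instance Definition _ := GRing.Lmodule_isLalgebra.Build (Kxza R) (tBMW R n)
  (@pscaleAl _ _ (@tBMW_relations _ (Kx R) (Kz R) (Ka R) n)).
HB.instance Definition _ := GRing.Lalgebra_isAlgebra.Build (Kxza R) (tBMW R n)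
  (@pscaleAr _ _ (@tBMW_relations _ (Kx R) (Kz R) (Ka R) n)).

End Instances.

Section Words.

Variables (R : realType) (n : nat).

Definition gen (k : kind) (i : 'I_n.-1) : tBMW R n :=
  pres_pi _ (letterg (Kxza R) k i).

Definition word_eval (w : seq (letter n)) : tBMW R n :=
  \prod_(l <- w) gen l.1 l.2.

(* Words in the g_i, h_i, e_i, f_i (no inverses) of index at most n - 2; the
   index of l.2 : 'I_n.-1 is l.2.+1. *)
Definition low_word (w : seq (letter n)) : bool :=
  all (fun l : letter n => (l.1 != kGinv) && (l.2.+1 <= n - 2)%N) w.

(* i is meant to be the last index, as imposed in [reduced_word]. *)
Definition Gamma (i : 'I_n.-1) : seq (tBMW R n) :=
  [:: 1; gen kG i; gen kG i * gen kE i; gen kH i; gen kE i; gen kF i].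

Definition reduced_word (u : tBMW R n) : Prop :=
  exists (i : 'I_n.-1) (d : tBMW R n) (w1 w2 : seq (letter n)),
    [/\ i.+1 = n.-1, d \in Gamma i, low_word w1, low_word w2
      & u = word_eval w1 * d * word_eval w2].

Definition reduced (u : tBMW R n) : Prop :=
  exists (m : nat) (c : 'I_m -> Kxza R) (w : 'I_m -> tBMW R n),
    (forall k, reduced_word (w k)) /\ u = \sum_(k < m) c k *: w k.

End Words.

Definition finite_dimensional (K : fieldType) (V : lmodType K) : Prop :=
  exists d : nat, inhabited (Vector.axiom d V).

(* Main.v *)
(* Let A_m be the span of the words in the letters of index < m, and let T_m be
   the span of the products p d q with p, q in A_m and d in
   Gamma = {1, g_m, g_m e_m, h_m, e_m, f_m}. By induction on m, A_{m+1} = T_m: it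
   suffices that T_m is stable under left multiplication by a letter D of index
   m. Since A_m = T_{m-1} and D commutes with A_{m-1}, this reduces to the
   products D c d with c in Gamma of index m - 1 and d in Gamma of index m.
   Writing 1, 2 for the indices m - 1, m, these are computed from three facts:
   e_2 c e_2 = c' e_2 with c' in {1, g_1 e_1, e_1, f_1}, each of which commutes
   with e_2; f_2 e_1 = e_1 h_2 e_1; and, z being invertible, the skein relation,
   which trades e or f for the other one and g, g^-1. Stability under e_2, h_2,
   f_2, g_2 is obtained in this order, each case using the previous ones.
   Finite dimensionality follows: A_0 is the line of scalars and each step
   multiplies finite spanning sets. *)
Require Import Defs.
From mathcomp Require Import all_boot all_algebra reals.
From mathcomp Require Import boolp fraction complex mpoly monalg.

Set Implicit Arguments.
Unset Strict Implicit.
Unset Printing Implicit Defensive.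

Import GRing.Theory.

Local Open Scope ring_scope.

(** * Linear spans and bases extracted from finite spanning families *)

Section LinearSpan.

Variables (K : pzRingType) (V : lmodType K).

Inductive lin_span (P : V -> Prop) : V -> Prop :=
| lin_span0 : lin_span P 0
| lin_spanS c w u of P w & lin_span P u : lin_span P (c *: w + u).

Variable P : V -> Prop.

Lemma lin_span_gen w : P w -> lin_span P w.
Proof.
by move=> Pw; rewrite -[w]scale1r -[_ *: _]addr0; apply: lin_spanS Pw (lin_span0 _).
Qed.

Lemma lin_spanD u v : lin_span P u -> lin_span P v -> lin_span P (u + v).
Proof.
move=> Pu Pv; elim: {u}Pu => [|c w u Pw _ IHu]; first by rewrite add0r.
by rewrite -addrA; apply: lin_spanS.
Qed.

Lemma lin_spanZ c u : lin_span P u -> lin_span P (c *: u).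
Proof.
elim=> [|d w v Pw _ IHv]; first by rewrite scaler0; apply: lin_span0.
by rewrite scalerDr scalerA; apply: lin_spanS.
Qed.

Lemma lin_spanN u : lin_span P u -> lin_span P (- u).
Proof. by rewrite -scaleN1r; apply: lin_spanZ. Qed.

Lemma lin_spanB u v : lin_span P u -> lin_span P v -> lin_span P (u - v).
Proof. by move=> Pu /lin_spanN; apply: lin_spanD. Qed.

Lemma lin_span_sum u : lin_span P u ->
  exists m (c : 'I_m -> K) (w : 'I_m -> V),
    (forall k, P (w k)) /\ u = \sum_(k < m) c k *: w k.
Proof.
elim=> {u} [|c w u Pw _ [m [c' [w' [Pw' ->]]]]].
  by exists 0%N, (fun=> 0), (fun=> 0); split; [case | rewrite big_ord0].
exists m.+1, (fun k => if unlift ord0 k is Some k' then c' k' else c).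
exists (fun k => if unlift ord0 k is Some k' then w' k' else w).
split=> [k|]; first by case: unliftP.
rewrite big_ord_recl unlift_none; congr (_ + _).
by apply: eq_bigr => k _; rewrite liftK.
Qed.

End LinearSpan.

Lemma lin_span_linear (K : pzRingType) (V W : lmodType K) (P : V -> Prop)
    (Q : W -> Prop) (phi : V -> W) :
  linear phi -> (forall w, P w -> lin_span Q (phi w)) ->
  forall u, lin_span P u -> lin_span Q (phi u).
Proof.
move=> lin_phi PQ u; elim=> {u} [|c w u Pw _ IHu].
  suff ->: phi 0 = 0 by apply: lin_span0.
  have := lin_phi 1 0 0; rewrite !scale1r addr0 => E.
  by apply: (addrI (phi 0)); rewrite addr0 -E.
by rewrite lin_phi; apply: lin_spanD => //; apply/lin_spanZ/PQ.
Qed.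

Lemma lin_span_sub (K : pzRingType) (V : lmodType K) (P Q : V -> Prop) :
  (forall w, P w -> lin_span Q w) -> forall u, lin_span P u -> lin_span Q u.
Proof. exact: (@lin_span_linear _ _ _ _ _ id). Qed.

(** The two-sided form lets [lin_span_linear] expand any single factor of a product; for one-sided
    multiplication [p] or [q] is 1, hence the factors 1 inserted in later proofs. *)
Lemma mul_linear (K : pzRingType) (A : algType K) (p q : A) :
  linear (fun u => p * u * q).
Proof. by move=> c u v; rewrite mulrDr -scalerAr mulrDl -scalerAl. Qed.

(* A spanning family of minimal length is a basis. *)
Lemma finite_dimensional_span (K : fieldType) (V : lmodType K) (s : seq V) :
  (forall u, lin_span (fun v => v \in s) u) -> finite_dimensional V.
Proof.
move=> s_span.
pose spanning d := exists b : 'I_d -> V,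
  forall u, exists r : 'rV[K]_d, u = \sum_k r 0 k *: b k.
have spanning_s : exists d, `[< spanning d >].
  exists (size s); apply/asboolP; exists (tnth (in_tuple s)) => u.
  elim: (s_span u) => {u} [|c w u /(tnthP (in_tuple s))[k ->] _ [r ->]].
    by exists 0; rewrite big1 // => k _; rewrite mxE scale0r.
  exists (c *: delta_mx 0 k + r).
  rewrite (bigD1 k) //= [in RHS](bigD1 k) //= !mxE !eqxx mulr1 scalerDl -addrA.
  congr (_ + (_ + _)); apply: eq_bigr => l /negPf lk.
  by rewrite !mxE lk andbF mulr0 add0r.
case: (ex_minnP spanning_s) => d /asboolP[b b_span] d_min; exists d.
have comb0 (r : 'rV[K]_d) : \sum_k r 0 k *: b k = 0 -> r = 0.
  move=> r0; apply/rowP=> k0; rewrite mxE; apply/eqP/negPn/negP => rk0.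
  case: d b b_span d_min r r0 k0 rk0 => [|d] b b_span d_min r r0 k0 rk0.
    by case: (k0).
  suff /d_min : `[< spanning d >] by rewrite ltnn.
  apply/asboolP; exists (b \o lift k0) => u; have [t ->] := b_span u.
  (* Subtracting [t 0 k0 / r 0 k0] times the relation [r] kills the coefficient at [k0]. *)
  exists (\row_k (t 0 (lift k0 k) - t 0 k0 / r 0 k0 * r 0 (lift k0 k))).
  have -> : \sum_k t 0 k *: b k
      = \sum_k (t 0 k - t 0 k0 / r 0 k0 * r 0 k) *: b k.
    transitivity (\sum_k t 0 k *: b k - (t 0 k0 / r 0 k0) *: \sum_k r 0 k *: b k).
      by rewrite r0 scaler0 subr0.
    rewrite scaler_sumr -sumrB.
    by apply: eq_bigr => k _; rewrite scalerA scalerBl.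
  rewrite (bigD1_ord k0) //= divfK // subrr scale0r add0r.
  by apply: eq_bigr => k _; rewrite mxE.
pose comb (r : 'rV[K]_d) := \sum_k r 0 k *: b k.
have comb_lin : linear comb.
  move=> c r t; rewrite /comb scaler_sumr -big_split /=; apply: eq_bigr => k _.
  by rewrite !mxE scalerDl scalerA.
(* Coordinates are picked by choice; independence makes them unique, hence linear in the vector. *)
have [v2r v2rK] : {v2r : V -> 'rV[K]_d | forall u, u = comb (v2r u)}.
  by exists (fun u => projT1 (cid (b_span u))) => u; case: cid.
have combK : cancel comb v2r.
  move=> r; apply/eqP; rewrite -subr_eq0; apply/eqP/comb0.
  rewrite -[LHS]/(comb _) addrC -scaleN1r comb_lin -v2rK.
  by rewrite scaleN1r addNr.
constructor; exists v2r; last by exists comb => // u; rewrite -v2rK.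
by move=> c u v; rewrite [in LHS](v2rK u) [in LHS](v2rK v) -comb_lin combK.
Qed.

(** * Consequences of the defining relations *)

Section TiedBMW.

Variables (K : fieldType) (x z a : K) (n : nat) (A : algType K).
Variable G : kind -> 'I_n.-1 -> A.

Notation g := (G kG).
Notation g' := (G kGinv).
Notation h := (G kH).
Notation e := (G kE).
Notation f := (G kF).

Hypotheses (z_neq0 : z != 0) (a_neq0 : a != 0).
Hypothesis rel : forall u v, tBMW_rel x z a g g' h e f u v -> u = v.

Lemma ggV i : g i * g' i = 1. Proof. by apply: rel; constructor. Qed.
Lemma gVg i : g' i * g i = 1. Proof. by apply: rel; constructor. Qed.
Lemma g_h i : g i * h i = a^-1 *: h i. Proof. by apply: rel; constructor. Qed.
Lemma h_g i : h i * g i = a^-1 *: h i. Proof. by apply: rel; constructor. Qed.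
Lemma e_e i : e i * e i = e i. Proof. by apply: rel; constructor. Qed.
Lemma e_g i : e i * g i = g i * e i. Proof. by apply: rel; constructor. Qed.
Lemma e_h i : e i * h i = h i. Proof. by apply: rel; constructor. Qed.
Lemma h_e i : h i * e i = h i. Proof. by apply: rel; constructor. Qed.
Lemma e_f i : e i * f i = f i. Proof. by apply: rel; constructor. Qed.
Lemma f_e i : f i * e i = f i. Proof. by apply: rel; constructor. Qed.
Lemma f_g i : f i * g i = a^-1 *: f i. Proof. by apply: rel; constructor. Qed.
Lemma g_f i : g i * f i = a^-1 *: f i. Proof. by apply: rel; constructor. Qed.
Lemma h_h i : h i * h i = x^-1 *: h i. Proof. by apply: rel; constructor. Qed.
Lemma e_eC i j : e i * e j = e j * e i. Proof. by apply: rel; constructor. Qed.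

Lemma skein i : g i + g' i = z *: (e i + f i).
Proof. by apply: rel; constructor. Qed.

(** The skein relation is solved for each of its four letters in turn; only solving for [f] and [e]
    divides by [z]. *)
Lemma gE i : g i = z *: (e i + f i) - g' i.
Proof. by rewrite -skein addrK. Qed.

Lemma gVE i : g' i = z *: (e i + f i) - g i.
Proof. by rewrite -skein addrC addKr. Qed.

Lemma fE i : f i = z^-1 *: (g i + g' i) - e i.
Proof. by rewrite skein scalerA mulVf // scale1r addrC addKr. Qed.

Lemma eE i : e i = z^-1 *: (g i + g' i) - f i.
Proof. by rewrite skein scalerA mulVf // scale1r addrK. Qed.

Lemma g_g i : g i * g i = z *: (g i * e i + a^-1 *: f i) - 1.
Proof. by rewrite [X in _ * X]gE mulrBr ggV -scalerAr mulrDr g_f. Qed.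

Lemma gV_h i : g' i * h i = a *: h i.
Proof.
by rewrite -[h i in LHS](scalerKV a_neq0) -g_h -scalerAr mulrA gVg mul1r.
Qed.

Lemma gV_f i : g' i * f i = a *: f i.
Proof.
by rewrite -[f i in LHS](scalerKV a_neq0) -g_f -scalerAr mulrA gVg mul1r.
Qed.

(** By skein, [f i] is a combination of [g i], [g' i] and [e i], which act on [h i] by the scalars
    [a^-1], [a] and 1. *)
Lemma f_h i : f i * h i = (z^-1 * (a^-1 + a) - 1) *: h i.
Proof.
by rewrite fE mulrBl -scalerAl mulrDl g_h gV_h e_h -scalerDl scalerA scalerBl scale1r.
Qed.

Lemma f_f i : f i * f i = (z^-1 * (a^-1 + a) - 1) *: f i.
Proof.
rewrite [X in X * _]fE mulrBl -scalerAl mulrDl g_f gV_f e_f -scalerDl scalerA.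
by rewrite scalerBl scale1r.
Qed.

Lemma h_gV i : h i * g' i = a *: h i.
Proof.
by rewrite -[h i in LHS](scalerKV a_neq0) -h_g -scalerAl -mulrA ggV mulr1.
Qed.

Lemma h_f i : h i * f i = (z^-1 * (a^-1 + a) - 1) *: h i.
Proof.
by rewrite fE mulrBr -scalerAr mulrDr h_g h_gV h_e -scalerDl scalerA scalerBl scale1r.
Qed.

(** * Relations between two adjacent indices *)

Section Adjacent.

Variables i j : 'I_n.-1.
Hypothesis adj_ij : adj i j.

Lemma adjC : adj j i. Proof. by move: adj_ij; rewrite /adj orbC. Qed.
Let adj_ji := adjC.

Lemma gee_ege : g i * e i * e j = e j * g i * e j.
Proof. by apply: rel; constructor. Qed.
Lemma eegC : e i * e j * g i = g i * e i * e j.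
Proof. by apply: rel; constructor. Qed.
Lemma f_eC : f i * e j = e j * f i. Proof. by apply: rel; constructor. Qed.
Lemma e_f_ehe : e j * f i = e j * h i * e j.
Proof. by apply: rel; constructor. Qed.
Lemma egg : e i * g j * g i = g j * g i * e j.
Proof. by apply: rel; constructor. Qed.
Lemma ggg : g i * g j * g i = g j * g i * g j.
Proof. by apply: rel; constructor. Qed.
Lemma hgh : h i * g j * h i = a *: h i. Proof. by apply: rel; constructor. Qed.
Lemma hhh : h i * h j * h i = h i. Proof. by apply: rel; constructor. Qed.
Lemma ggh : g i * g j * h i = h j * h i.
Proof.
transitivity (h j * g i * g j); first by apply: rel; constructor.
by apply: rel; constructor.
Qed.
Lemma hgg : h j * g i * g j = h j * h i.
Proof. by apply: rel; constructor. Qed.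
Lemma ghh : g i * h j * h i = g' j * h i. Proof. by apply: rel; constructor. Qed.
Lemma hhg : h i * h j * g i = h i * g' j. Proof. by apply: rel; constructor. Qed.
Lemma gfg : g i * f j * g i = g' j * f i * g' j.
Proof. by apply: rel; constructor. Qed.

Lemma e_geC : e j * (g i * e i) = g i * e i * e j.
Proof. by rewrite -{1}e_g mulrA e_eC eegC. Qed.

End Adjacent.

Section AdjacentDerived.

Variables i j : 'I_n.-1.
Hypothesis adj_ij : adj i j.
Let adj_ji := adjC adj_ij.

(** A recurring device: [h j] absorbs [e j], so an [e j] can be inserted beside it to act on the
    letter of index [i]. *)
Lemma hfC_e : h j * f i = h j * h i * e j.
Proof. by rewrite -{1}(h_e j) -mulrA e_f_ehe // !mulrA h_e. Qed.

Lemma hfh : h j * f i * h j = h j.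
Proof. by rewrite hfC_e -mulrA e_h hhh //. Qed.

Lemma hgVh : h j * g' i * h j = a^-1 *: h j.
Proof. by rewrite -(hhg adj_ji) -mulrA g_h -scalerAr (hhh adj_ji). Qed.

Lemma heh : h j * e i * h j = (z^-1 * (a + a^-1) - 1) *: h j.
Proof.
rewrite eE mulrBr mulrBl hfh -scalerAr -scalerAl mulrDr mulrDl.
by rewrite (hgh adj_ji) hgVh -scalerDl scalerA scalerBl scale1r.
Qed.

Lemma hgeh : h j * (g i * e i) * h j = a *: h j.
Proof.
rewrite -{2}(e_h j) -mulrA (mulrA _ (e j)) gee_ege // !mulrA h_e -mulrA.
by rewrite -mulrA e_h mulrA (hgh adj_ji).
Qed.

Lemma ehe : e j * h i * e j = f i * e j.
Proof. by rewrite -e_f_ehe // f_eC. Qed.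

Lemma f_e_ehe : f j * e i = e i * h j * e i.
Proof. by rewrite f_eC // e_f_ehe. Qed.

Lemma f_f_adj : f i * f j = f i * h j * e i.
Proof.
have E : e i * f j = e i * h j * e i by rewrite e_f_ehe //.
by rewrite -{1}(f_e i) -mulrA E !mulrA f_e.
Qed.

Lemma hhf : h j * h i * f j = h j * e i.
Proof.
by rewrite -(e_f j) mulrA -hfC_e -mulrA f_f_adj !mulrA hfh.
Qed.

Lemma eVgeC : e j * (g' i * e i) = g' i * e i * e j.
Proof.
rewrite gVE mulrBl mulrBr mulrBl e_geC // -!(scalerAl, scalerAr).
rewrite mulrDl mulrDr [in RHS]mulrDl e_e f_e (e_eC j) f_eC //.
Qed.

Lemma egVe : e j * g' i * e j = g' i * e i * e j.
Proof.
rewrite gVE mulrBr !mulrBl -(gee_ege adj_ij) -!(scalerAl, scalerAr).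
by rewrite mulrDr !mulrDl e_e f_e -(f_eC adj_ij) (e_eC j) -!mulrA e_e.
Qed.

Lemma hgVe : h j * g' i * e j = h j * (g' i * e i).
Proof.
rewrite -{1}(h_e j) -!mulrA (mulrA (e j)) egVe -eVgeC.
by rewrite [LHS]mulrA h_e.
Qed.

Lemma hfg : h j * f i * g j = h j * (g' i * e i).
Proof. by rewrite hfC_e -mulrA e_g mulrA (hhg adj_ji) hgVe. Qed.

(** Since [h j * g' i] is [h j * h i * g j], the square of [g j] appears, and [g_g] expands it. *)
Lemma hgVg : h j * g' i * g j =
  z *: (h j * (g' i * e i)) + (z * a^-1) *: (h j * e i) - h j * h i.
Proof.
rewrite -(hhg adj_ji) -mulrA g_g mulrBr mulr1 -scalerAr mulrDr.
by rewrite (mulrA (h j * h i) (g j)) (hhg adj_ji) hgVe -scalerAr hhf scalerDr scalerA.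
Qed.

Lemma hgeg : h j * (g i * e i) * g j = h j * f i.
Proof.
rewrite -{1}(h_e j) -(mulrA (h j)) e_geC // gee_ege // !mulrA h_e.
by rewrite -mulrA e_g mulrA hgg // hfC_e.
Qed.

(** Multiply [gfg] by [g' i] on the left and by [g j] on the right. *)
Lemma fgg : f j * g i * g j = g' i * g' j * f i.
Proof.
rewrite -[f j]mul1r -(gVg i) -!mulrA (mulrA (f j)) (mulrA (g i)).
by rewrite (mulrA (g i)) gfg // -!mulrA gVg mulr1.
Qed.

Lemma ggf : g j * g i * f j = f i * g' j * g' i.
Proof.
rewrite -[f j]mulr1 -(ggV i) !mulrA -(mulrA (g j)) -(mulrA (g j)) gfg //.
by rewrite !mulrA ggV mul1r.
Qed.

Lemma gVh : g' j * h i = g i * h j * h i.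
Proof. by rewrite ghh. Qed.

Lemma hgV : h i * g' j = h i * h j * g i.
Proof. by rewrite hhg. Qed.

Lemma g_e : g j * e i = g' i * e j * g i * g j.
Proof. by rewrite -!mulrA (mulrA (e j)) egg // !mulrA gVg mul1r. Qed.

Lemma ehf : e j * h i * f j = f i * h j * e i.
Proof. by rewrite -{1}(e_f j) mulrA ehe -mulrA e_f f_f_adj. Qed.

Lemma ehh : e j * h i * h j = f i * h j.
Proof. by rewrite -{1}(e_h j) mulrA ehe -mulrA e_h. Qed.

Lemma ehgV : e j * h i * g' j = f i * h j * g i.
Proof. by rewrite -mulrA hgV !mulrA ehh. Qed.

(** The skein relation replaces [g j] by [e j], [f j] and [g' j], to which [ehe], [ehf] and [ehgV]
    apply. *)
Lemma ehg : e j * h i * g j =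
  z *: (f i * e j + f i * h j * e i) - f i * h j * g i.
Proof.
by rewrite [g j]gE mulrBr -scalerAr mulrDr ehe ehf ehgV.
Qed.

End AdjacentDerived.

(** * Reduction of words *)

(* Spans are taken over words without [kGinv], which the skein relation expresses
   through the other letters. *)
Definition below (m : nat) (w : seq (letter n)) : bool :=
  all (fun l : letter n => (l.1 != kGinv) && (l.2 < m)%N) w.

Definition evalw (w : seq (letter n)) : A := \prod_(l <- w) G l.1 l.2.

Definition gam (i : 'I_n.-1) : seq A := [:: 1; g i; g i * e i; h i; e i; f i].

(** The space A of the outline; [sandwich i] is the space T whose middle letter has index [i]. *)
Definition subalg (m : nat) : A -> Prop :=
  lin_span (fun u => exists2 w, below m w & u = evalw w).

Definition sandwich (i : 'I_n.-1) : A -> Prop :=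
  lin_span (fun u => exists d w1 w2,
    [/\ d \in gam i, below i w1, below i w2 & u = evalw w1 * d * evalw w2]).

Lemma evalw_nil : evalw [::] = 1. Proof. exact: big_nil. Qed.

Lemma evalw_cat w1 w2 : evalw (w1 ++ w2) = evalw w1 * evalw w2.
Proof. exact: big_cat. Qed.

Lemma evalw_cons l w : evalw (l :: w) = G l.1 l.2 * evalw w.
Proof. exact: big_cons. Qed.

Lemma subalg_gen m k (i : 'I_n.-1) : (i < m)%N -> subalg m (G k i).
Proof.
move=> im.
have gen k' : k' != kGinv -> subalg m (G k' i).
  move=> k'V; apply: lin_span_gen; exists [:: (k', i)]; first by rewrite /= k'V im.
  by rewrite evalw_cons evalw_nil mulr1.
case: (k =P kGinv) => [->|/eqP]; last exact: gen.
rewrite gVE; apply: lin_spanB; last exact: gen.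
by apply/lin_spanZ/lin_spanD; apply: gen.
Qed.

Lemma sandwich_mull (i : 'I_n.-1) p u : subalg i p -> sandwich i u -> sandwich i (p * u).
Proof.
move=> Bp Tu; rewrite -[p]mul1r.
apply: (lin_span_linear (mul_linear 1 u)) Bp => {p} _ [w bw ->].
rewrite mul1r -[_ * u]mulr1.
apply: (lin_span_linear (mul_linear _ _)) Tu => {u} _ [d [w1 [w2 [dG b1 b2 ->]]]].
apply: lin_span_gen; exists d, (w ++ w1), w2; split=> //; last first.
  by rewrite evalw_cat mulr1 !mulrA.
by rewrite /below all_cat; apply/andP.
Qed.

Lemma sandwich_mulr (i : 'I_n.-1) p u : subalg i p -> sandwich i u -> sandwich i (u * p).
Proof.
move=> Bp Tu; rewrite -[u * p]mulr1.
apply: (lin_span_linear (mul_linear u 1)) Bp => {p} _ [w bw ->].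
rewrite mulr1 -[u]mul1r.
apply: (lin_span_linear (mul_linear _ _)) Tu => {u} _ [d [w1 [w2 [dG b1 b2 ->]]]].
apply: lin_span_gen; exists d, w1, (w2 ++ w); split=> //; last first.
  by rewrite evalw_cat mul1r !mulrA.
by rewrite /below all_cat; apply/andP.
Qed.

Lemma sandwichD i u v : sandwich i u -> sandwich i v -> sandwich i (u + v).
Proof. exact: lin_spanD. Qed.

Lemma sandwichB i u v : sandwich i u -> sandwich i v -> sandwich i (u - v).
Proof. exact: lin_spanB. Qed.

Lemma sandwichZ i c u : sandwich i u -> sandwich i (c *: u).
Proof. exact: lin_spanZ. Qed.

Lemma sandwich_gam i d : d \in gam i -> sandwich i d.
Proof.
move=> dG; apply: lin_span_gen; exists d, [::], [::]; split=> //.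
by rewrite evalw_nil mul1r mulr1.
Qed.

Lemma sandwich_gen i k : sandwich i (G k i).
Proof.
have gen k' : k' != kGinv -> sandwich i (G k' i).
  by move=> k'V; apply: sandwich_gam; case: k' k'V => //; rewrite !inE eqxx ?orbT.
case: (k =P kGinv) => [->|/eqP]; last exact: gen.
rewrite gVE; apply: sandwichB; last exact: gen.
by apply/sandwichZ/sandwichD; apply: gen.
Qed.

Lemma sandwich_ge i : sandwich i (g i * e i).
Proof. by apply: sandwich_gam; rewrite !inE eqxx ?orbT. Qed.

Lemma sandwich1 i : sandwich i 1.
Proof. by apply: sandwich_gam; rewrite !inE eqxx. Qed.

Lemma gamP (P : A -> Prop) i :
  P 1 -> P (g i) -> P (g i * e i) -> P (h i) -> P (e i) -> P (f i) ->
  forall d, d \in gam i -> P d.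
Proof.
move=> P1 P2 P3 P4 P5 P6 d; rewrite !inE.
by do 5![case/predU1P=> [->//|]]; move/eqP->.
Qed.

(** Only relations within one index are involved. This settles index 0, where the outer words are
    empty, and later the products with nothing between the two letters of index [i]. *)
Lemma sandwich_gen_gam i k d : d \in gam i -> sandwich i (G k i * d).
Proof.
have G1 := sandwich_gen i; have G2 := sandwich_ge i; have G3 := sandwich1 i.
have gen k' d' : k' != kGinv -> d' \in gam i -> sandwich i (G k' i * d').
  move=> k'V; move: d'; apply: gamP; first by rewrite mulr1.
  - case: k' k'V => // _.
    + by rewrite g_g; do !(apply: sandwichB || apply: sandwichD || apply: sandwichZ).
    + by rewrite h_g; apply: sandwichZ.
    + by rewrite e_g.
    + by rewrite f_g; apply: sandwichZ.
  - case: k' k'V => // _; rewrite mulrA.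
    + rewrite g_g mulrBl mul1r -scalerAl mulrDl -scalerAl -mulrA e_e f_e.
      by do !(apply: sandwichB || apply: sandwichD || apply: sandwichZ).
    + by rewrite h_g -scalerAl h_e; apply: sandwichZ.
    + by rewrite e_g -mulrA e_e.
    + by rewrite f_g -scalerAl f_e; apply: sandwichZ.
  - case: k' k'V => // _;
      rewrite ?(g_h, h_h, e_h, f_h) //; exact: sandwichZ.
  - case: k' k'V => // _; rewrite ?(h_e, e_e, f_e) //.
  - case: k' k'V => // _;
      rewrite ?(g_f, h_f, e_f, f_f) //; exact: sandwichZ.
move=> dG; case: (k =P kGinv) => [->|/eqP kV]; last exact: gen.
rewrite gVE mulrBl -scalerAl mulrDl; apply: sandwichB; last exact: gen.
by apply/sandwichZ/sandwichD; apply: gen.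
Qed.

(** Commuting with [g i] passes to its inverse, and the skein relation then yields [f i]. This
    supplies the far commutations absent from the defining relations. *)
Lemma comm_letters (p : A) i :
  GRing.comm p (g i) -> GRing.comm p (h i) -> GRing.comm p (e i) ->
  forall k, GRing.comm p (G k i).
Proof.
move=> pg ph pe.
have pgV : GRing.comm p (g' i).
  by rewrite /GRing.comm -[LHS]mul1r -(gVg i) mulrA -(mulrA _ _ p) -pg -!mulrA ggV mulr1.
case=> //; rewrite fE; apply: commrB => //.
by rewrite /GRing.comm -scalerAr -scalerAl; congr (_ *: _); apply: commrD.
Qed.

Lemma far_comm k l i j : far i j -> GRing.comm (G k i) (G l j).
Proof.
move=> fij; have fji : far j i by rewrite /far orbC.
have comm_g k' i' j' : far i' j' -> GRing.comm (g i') (G k' j').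
  move=> fij'; have fji' : far j' i' by rewrite /far orbC.
  by apply: comm_letters; [| |apply/commr_sym]; apply: rel; constructor.
have comm_e k' i' j' : far i' j' -> GRing.comm (e i') (G k' j').
  by move=> fij'; apply: comm_letters; apply: rel; constructor.
apply: comm_letters; apply/commr_sym; [exact: comm_g | | exact: comm_e].
apply: comm_letters; last by apply/commr_sym/comm_e.
- by apply/commr_sym/comm_g.
- by apply: rel; constructor.
Qed.

Lemma far_comm_eval k (i : 'I_n.-1) m w : (m < i)%N -> below m w -> GRing.comm (G k i) (evalw w).
Proof.
move=> mi; elim: w => [|l w IHw] /=; first by rewrite evalw_nil => _; apply: commr1.
case/andP=> /andP[_ lm] bw; rewrite evalw_cons; apply: commrM; last exact: IHw.
by apply: far_comm; rewrite /far (leq_ltn_trans lm mi) orbT.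
Qed.

(** * The induction step: letters of index [i] acting on the left, with [o] the index just below *)

Section Step.

Variables o i : 'I_n.-1.
Hypothesis oi : o.+1 = i.

Notation T := (sandwich i).

Let adj_oi : adj o i. Proof. by rewrite /adj oi eqxx. Qed.
Let adj_io : adj i o. Proof. exact: adjC. Qed.

Let Tl k u : T u -> T (G k o * u).
Proof. by apply/sandwich_mull/subalg_gen; rewrite -oi. Qed.

Let Tr k u : T u -> T (u * G k o).
Proof. by apply/sandwich_mulr/subalg_gen; rewrite -oi. Qed.

Let Tg : forall k, T (G k i). Proof. exact: sandwich_gen. Qed.
Let Tge : T (g i * e i). Proof. exact: sandwich_ge. Qed.
Let T1 : T 1. Proof. exact: sandwich1. Qed.

(* Membership of a product of letters that visibly has the shape low * d * low. *)
Ltac low :=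
  rewrite -?mulrA; do ?apply: Tl; rewrite ?mulrA; do ?apply: Tr;
  rewrite -?mulrA; do ?apply: Tl; by [].

Lemma sandwich_gam_mull c d : c \in gam o -> T d -> T (c * d).
Proof.
move=> cG Td; move: c cG; apply: gamP; rewrite ?mul1r // -?mulrA; do ?apply: Tl => //.
Qed.

Lemma sandwich_gam_mulr c d : c \in gam o -> T d -> T (d * c).
Proof.
move=> cG Td; move: c cG; apply: gamP; rewrite ?mulr1 // ?mulrA; do ?apply: Tr => //.
Qed.

(** The members of [gam o] other than [g o] and [h o]: they commute with [e i] and are the values c'
    of the outline. *)
Definition tied : seq A := [:: 1; g o * e o; e o; f o].

Lemma tied_gam c : c \in tied -> c \in gam o.
Proof. by rewrite !inE => /or4P[] /eqP->; rewrite eqxx ?orbT. Qed.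

Lemma tiedC c : c \in tied -> e i * c = c * e i.
Proof.
rewrite !inE => /or4P[] /eqP->; first by rewrite mulr1 mul1r.
- exact: e_geC.
- exact: e_eC.
- by rewrite f_eC.
Qed.

(** A tied [c] commutes with the idempotent [e i], so c' is [c] itself; [g o] becomes [g o * e o]
    and [h o] becomes [f o]. *)
Lemma e_gam_e c : c \in gam o -> exists2 c', c' \in tied & e i * c * e i = c' * e i.
Proof.
have tiedE c' : c' \in tied -> exists2 c0, c0 \in tied & e i * c' * e i = c0 * e i.
  by move=> tc'; exists c' => //; rewrite tiedC // -mulrA e_e.
move: c; apply: gamP; try by apply: tiedE; rewrite !inE eqxx ?orbT.
  by exists (g o * e o); rewrite ?gee_ege // !inE eqxx ?orbT.
by exists (f o); rewrite ?ehe // !inE eqxx ?orbT.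
Qed.

Lemma tied_cases (P : A -> Prop) :
  (forall c, c \in tied -> P c) -> P (g o) -> P (h o) -> forall c, c \in gam o -> P c.
Proof.
by move=> Pt Pg Ph; apply: gamP => //; apply: Pt; rewrite !inE eqxx ?orbT.
Qed.

(** This allows an [e o] to be inserted beside any tied element but 1, so that
    [f i * e o = e o * h i * e o] becomes applicable. *)
Lemma tied_e c : c \in tied -> c = 1 \/ [/\ e o * c = c & c * e o = c].
Proof.
rewrite !inE => /or4P[] /eqP->; [by left | right..].
- by rewrite mulrA e_g -!mulrA !e_e.
- by rewrite e_e.
- by rewrite e_f f_e.
Qed.

(** Every [d] other than 1 and [g i] absorbs [e i] on its left, which creates the pattern
    [e i * c * e i]. *)
Lemma gam_e (P : A -> Prop) :
  P 1 -> P (g i) -> (forall d, d \in gam i -> e i * d = d -> P d) ->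
  forall d, d \in gam i -> P d.
Proof.
move=> P1 Pg Pe; apply: gamP => //; apply: Pe;
  rewrite ?inE ?eqxx ?orbT ?e_h ?e_e ?e_f //.
by rewrite mulrA e_g -mulrA e_e.
Qed.

(** The induction hypothesis, one index down. *)
Hypothesis subalg_sandwich : forall p, subalg i p -> sandwich o p.

(** The left outer word of [u] expands into terms [v1 * c * v2] with [v1], [v2] below [o]. Then [v1]
    commutes with [G k i] and [v2] with [d], so both move outside [G k i * c * d]. *)
Lemma sandwich_mul_crit k :
  (forall c d, c \in gam o -> d \in gam i -> T (G k i * c * d)) ->
  forall u, T u -> T (G k i * u).
Proof.
move=> Tcd u; rewrite -[_ * u]mulr1.
apply: (lin_span_linear (mul_linear _ _)) => {u} _ [d [w1 [w2 [dG b1 b2 ->]]]].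
rewrite mulr1 2!mulrA; apply: sandwich_mulr.
  by apply: lin_span_gen; exists w2.
have : sandwich o (evalw w1).
  by apply: subalg_sandwich; apply: lin_span_gen; exists w1.
move: (evalw w1).
apply: (lin_span_linear (mul_linear _ _)) => _ [c [v1 [v2 [cG c1 c2 ->]]]].
have sub v : below o v -> subalg i (evalw v).
  move=> bv; apply: lin_span_gen; exists v => //.
  by apply: sub_all bv => -[l1 l2] /andP[-> /= /ltn_trans->//]; rewrite -oi.
rewrite (_ : _ * d = evalw v1 * (G k i * c * d) * evalw v2).
  apply: sandwich_mulr (sub _ c2) _; apply: sandwich_mull (sub _ c1) _.
  exact: Tcd.
have oi' : (o < i)%N by rewrite -oi.
have E1 := far_comm_eval k oi' c1.
have E2 : GRing.comm d (evalw v2).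
  apply/commr_sym; move: d dG {Tcd}.
  by apply: gamP; [exact: commr1| |apply: commrM| | |];
    exact: commr_sym (far_comm_eval _ oi' c2).
by rewrite !mulrA E1 -!mulrA E2.
Qed.

Lemma sandwich_e_mul u : T u -> T (e i * u).
Proof.
apply: sandwich_mul_crit => c d cG; move: d; apply: gam_e.
- by rewrite mulr1; apply: sandwich_gam_mulr.
- move: c cG; apply: tied_cases => [c tc||].
  + by rewrite tiedC // -mulrA e_g; apply: sandwich_gam_mull (tied_gam tc) _.
  + by rewrite egg //; low.
  + rewrite ehg //; apply: sandwichB; last low.
    by apply/sandwichZ/sandwichD; low.
- move=> d dG ed; have [c' tc' E] := e_gam_e cG.
  rewrite -[X in _ * X]ed mulrA E -mulrA ed.
  by apply: sandwich_gam_mull (tied_gam tc') _; apply: sandwich_gam.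
Qed.

Lemma h_tied_gam c d : c \in tied -> d \in gam i -> T (h i * c * d).
Proof.
move=> tc dG; case: (tied_e tc) => [->|[ec ce]].
  by rewrite mulr1; apply: sandwich_gen_gam.
have cases (P : A -> Prop) : P 1 -> P (g o * e o) -> P (e o) -> P (f o) -> P c.
  by move: tc; rewrite !inE => /or4P[] /eqP->.
have T_hc : T (h i * c) by apply: sandwich_gam_mulr (tied_gam tc) _.
have T_hcg : T (h i * c * g i).
  apply: (cases (fun c => T (h i * c * g i))); first by rewrite mulr1 h_g; apply: sandwichZ.
  - by rewrite hgeg //; low.
  (* No direct formula is used for [h i * e o * g i]: skein trades [e o] for [g o], [g' o] and
     [f o]. *)
  - rewrite eE mulrBr mulrBl -scalerAr -scalerAl mulrDr mulrDl hgg // hgVg // hfg //.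
    apply: sandwichB; last low.
    apply/sandwichZ/sandwichD; first low.
    by apply: sandwichB; [apply: sandwichD; apply: sandwichZ|]; low.
  - by rewrite hfg //; low.
have T_hch : T (h i * c * h i).
  apply: (cases (fun c => T (h i * c * h i))); first by rewrite mulr1 h_h; apply: sandwichZ.
  - by rewrite hgeh //; apply: sandwichZ.
  - by rewrite heh //; apply: sandwichZ.
  - by rewrite hfh.
move: d dG; apply: gamP => //; first by rewrite mulr1.
- by rewrite -e_g mulrA -(mulrA (h i)) -tiedC // (mulrA (h i)) h_e.
- by rewrite -mulrA -tiedC // mulrA h_e.
(* Writing [c] as [c * e o] turns [f i] into [h i * e o], which reduces to [T_hch]. *)
- rewrite -{1}ce -!mulrA e_f_ehe // !mulrA -(mulrA _ c) ce.
  exact: Tr.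
Qed.

Lemma sandwich_h_mul u : T u -> T (h i * u).
Proof.
apply: sandwich_mul_crit => c d cG; move: d; apply: gam_e.
- by rewrite mulr1; apply: sandwich_gam_mulr.
- move: c cG; apply: tied_cases => [c tc||].
  + by apply: h_tied_gam => //; rewrite !inE eqxx ?orbT.
  + by rewrite hgg //; low.
  + by rewrite hhg //; low.
- move=> d dG ed; have [c' tc' E] := e_gam_e cG.
  rewrite (_ : _ * d = h i * (e i * c * e i) * d); last first.
    by rewrite !mulrA h_e -!mulrA ed.
  by rewrite E mulrA -mulrA ed; apply: h_tied_gam.
Qed.

Lemma f_tied_gam c d : c \in tied -> d \in gam i -> T (f i * c * d).
Proof.
move=> tc dG; case: (tied_e tc) => [->|[ec ce]].
  by rewrite mulr1; apply: sandwich_gen_gam.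
(* Writing [c] as [e o * c] turns [f i * e o] into [e o * h i * e o], so stability under [h i]
   suffices. *)
rewrite -ec mulrA f_e_ehe // -!mulrA (mulrA (e o) c) ec; apply/Tl/sandwich_h_mul.
by rewrite -ec -mulrA; apply/Tl/sandwich_gam_mull; [apply: tied_gam | apply: sandwich_gam].
Qed.

Lemma sandwich_f_mul u : T u -> T (f i * u).
Proof.
have fe c d : c \in gam o -> d \in gam i -> e i * d = d -> T (f i * c * d).
  move=> cG dG ed; have [c' tc' E] := e_gam_e cG.
  rewrite (_ : _ * d = f i * (e i * c * e i) * d); last first.
    by rewrite !mulrA f_e -!mulrA ed.
  by rewrite E mulrA -mulrA ed; apply: f_tied_gam.
apply: sandwich_mul_crit => c d cG; move: d; apply: gam_e; last by move=> d; apply: fe.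
- by rewrite mulr1; apply: sandwich_gam_mulr.
- have gG : g i \in gam i by rewrite !inE eqxx ?orbT.
  move: c cG; apply: tied_cases => [c tc||].
  + exact: f_tied_gam.
  + by rewrite fgg //; low.
  + have hG : h o \in gam o by rewrite !inE eqxx ?orbT.
    (* For [f i * h o * g i], skein produces [e i] and [f i], covered by [fe], and [g' i], where
       [h o * g' i = h o * h i * g o] leads back to [fe] with [d] equal to [h i]. *)
    rewrite [g i]gE mulrBr -scalerAr mulrDr; apply: sandwichB.
      by apply/sandwichZ/sandwichD; apply: fe;
        rewrite ?e_e ?e_f ?inE ?eqxx ?orbT.
    rewrite -mulrA hgV // !mulrA; apply: Tr; apply: fe; rewrite ?e_h //.
    by rewrite !inE eqxx ?orbT.
Qed.

(** By skein only [g' i * h o] remains beyond the stability under [e i] and [f i]; it equals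
    [g o * h i * h o]. *)
Lemma sandwich_gh_mul u : T u -> T (g i * (h o * u)).
Proof.
move=> Tu; have Thu : T (h o * u) by apply: Tl.
rewrite gE mulrBl -scalerAl mulrDl; apply: sandwichB.
  by apply/sandwichZ/sandwichD; [apply: sandwich_e_mul | apply: sandwich_f_mul].
by rewrite mulrA gVh // -!mulrA; apply/Tl/sandwich_h_mul.
Qed.

Lemma sandwich_gg_gam d : d \in gam i -> T (g i * g o * d).
Proof.
move: d; apply: gamP; first by rewrite mulr1; low.
- by rewrite -ggg //; low.
- by rewrite mulrA -ggg // -!mulrA (mulrA (g i)) -egg //; low.
- by rewrite ggh //; low.
- by rewrite -egg //; low.
- by rewrite ggf //; low.
Qed.

Lemma sandwich_ge_gam d : d \in gam i -> T (g i * e o * d).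
Proof.
move: d; apply: gam_e; first by rewrite mulr1; low.
(* [g i * e o = g' o * e i * g o * g i] brings [e i] forward and leaves a square of [g i] to
   expand. *)
- rewrite g_e // -mulrA g_g -!mulrA; apply/Tl/sandwich_e_mul/Tl.
  by apply/sandwichB => //; do !(apply: sandwichZ || apply: sandwichD).
- move=> d dG ed; rewrite -ed mulrA -(mulrA (g i)) (e_eC o) mulrA -eegC //.
  rewrite (e_eC i) -!mulrA; apply/Tl/sandwich_e_mul.
  exact: sandwich_gen_gam.
Qed.

Lemma sandwich_gf_gam d : d \in gam i -> T (g i * f o * d).
Proof.
have gfe : g i * f o * e i = g i * e i * f o by rewrite -mulrA f_eC // mulrA.
have gfh : T (g i * f o * h i).
  (* [f o * h i = e i * h o * h i], and [e i] commutes with [g i]. *)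
  rewrite -mulrA -ehh // -!mulrA mulrA -e_g -!mulrA.
  exact/sandwich_e_mul/sandwich_gh_mul.
move: d; apply: gamP => //; first by rewrite mulr1; low.
- by rewrite gfg //; low.
- by rewrite mulrA gfg // -!mulrA; apply/Tl/sandwich_f_mul/Tl.
- by rewrite gfe; low.
- by rewrite -mulrA f_f_adj // 2!mulrA; apply: Tr.
Qed.

Lemma sandwich_g_mul u : T u -> T (g i * u).
Proof.
apply: sandwich_mul_crit => c d cG dG; move: c cG; apply: tied_cases => [c||].
- rewrite !inE => /or4P[] /eqP->.
  + by rewrite mulr1; apply: sandwich_gen_gam.
  + move: d dG; apply: gam_e.
    * by rewrite mulr1; low.
    * rewrite -e_g !mulrA g_e // -!mulrA; apply/Tl/sandwich_e_mul.
      by rewrite (mulrA (g i)) -ggg //; low.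
    (* After inserting [e i] before [d], [g o * e o * e i = e i * g o * e i]; the new [e i] moves
       left past [g i], leaving [g i * g o * d]. *)
    * move=> d dG ed; rewrite -ed (mulrA _ (e i)) -(mulrA (g i)) gee_ege //.
      rewrite -!mulrA ed mulrA -e_g -!mulrA; apply: sandwich_e_mul.
      by rewrite mulrA; apply: sandwich_gg_gam.
  + exact: sandwich_ge_gam.
  + exact: sandwich_gf_gam.
- exact: sandwich_gg_gam.
- by rewrite -mulrA; apply/sandwich_gh_mul/sandwich_gam.
Qed.

Lemma sandwich_gen_mul k u : T u -> T (G k i * u).
Proof.
move=> Tu; have Tgu := sandwich_g_mul Tu; have Teu := sandwich_e_mul Tu.
have Tfu := sandwich_f_mul Tu.
case: k => //; last exact: sandwich_h_mul.
by rewrite gVE mulrBl -scalerAl mulrDl; apply/sandwichB/Tgu/sandwichZ/sandwichD.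
Qed.

End Step.

(** The space [sandwich i] contains 1 and is stable under left multiplication by every letter of
    index at most [i], hence contains all words in them. *)
Lemma subalg_ltS (m : nat) (i : 'I_n.-1) u : m = i -> subalg m.+1 u -> sandwich i u.
Proof.
elim/ltn_ind: m i u => m IHm i u mi.
have i_closed k v : sandwich i v -> sandwich i (G k i * v).
  case: m => [|m] in IHm mi *.
    rewrite -[_ * v]mulr1.
    apply: (lin_span_linear (mul_linear _ _)) => {v} _ [d [w1 [w2 [dG b1 b2 ->]]]].
    have nil w : below i w -> w = [::].
      by case: w => // l w /=; rewrite -mi ltn0 andbF.
    rewrite (nil _ b1) (nil _ b2) evalw_nil mul1r !mulr1.
    exact: sandwich_gen_gam.
  have lt_o : (m < n.-1)%N by rewrite ltnW // mi.
  apply: (@sandwich_gen_mul (Ordinal lt_o)) => //= p; rewrite -mi.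
  exact: (IHm _ (ltnSn m) (Ordinal lt_o)).
apply: lin_span_sub => _ [w bw ->].
elim: w bw => [_|l w IHw]; first by rewrite evalw_nil; apply: sandwich1.
rewrite evalw_cons => /= /andP[/andP[_ lm] /IHw Tw].
move: lm; rewrite ltnS leq_eqVlt => /predU1P[lm|lm].
  by have -> : l.2 = i; [apply: val_inj; rewrite /= lm | apply: i_closed].
by apply: sandwich_mull Tw; apply: subalg_gen; rewrite -mi.
Qed.

Lemma subalg_finite m : (m <= n.-1)%N ->
  exists s : seq A, forall u, subalg m u -> lin_span (fun v => v \in s) u.
Proof.
elim: m => [_|m IHm lt_m].
  exists [:: 1]; apply: lin_span_sub => _ [w bw ->].
  case: w bw => [_|l w]; last by rewrite /= ltn0 andbF.
  by apply: lin_span_gen; rewrite evalw_nil mem_head.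
have [s s_span] := IHm (ltnW lt_m); pose i := Ordinal lt_m.
exists [seq p * q | p <- [seq p * d | p <- s, d <- gam i], q <- s] => u.
move=> /(@subalg_ltS m i _ erefl); apply: lin_span_sub => _ [d [w1 [w2 [dG b1 b2 ->]]]].
have spanw w : below i w -> lin_span (fun v => v \in s) (evalw w).
  by move=> bw; apply: s_span; apply: lin_span_gen; exists w.
move: (spanw _ b1) (spanw _ b2); move: (evalw w1) (evalw w2) => p q sp sq.
rewrite -[p]mul1r -mulrA.
apply: (lin_span_linear (mul_linear 1 _)) sp => {}p ps.
rewrite mul1r mulrA -[_ * q]mulr1.
apply: (lin_span_linear (mul_linear _ _)) sq => {}q qs.
apply: lin_span_gen; rewrite mulr1.
by apply: allpairs_f => //; apply: allpairs_f.
Qed.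

Lemma subalg_mul_gen k i u : subalg n.-1 u -> subalg n.-1 (G k i * u).
Proof.
have gen k' w : k' != kGinv -> below n.-1 w -> subalg n.-1 (G k' i * evalw w).
  move=> k'V bw; apply: lin_span_gen; exists ((k', i) :: w); last by rewrite evalw_cons.
  by rewrite /= k'V ltn_ord.
rewrite -[_ * u]mulr1; apply: (lin_span_linear (mul_linear _ _)) => {u} _ [w bw ->].
rewrite mulr1; case: (k =P kGinv) => [->|/eqP kV]; last exact: gen.
rewrite gVE mulrBl -scalerAl mulrDl; apply: lin_spanB; last exact: gen.
by apply/lin_spanZ/lin_spanD; apply: gen.
Qed.

End TiedBMW.

(** Each side of a relation for the image family is the image under [phi] of the same side for
    [G]. *)
Lemma tBMW_rel_map (K : fieldType) (x z a : K) (n : nat) (A B : lalgType K)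
    (phi : A -> B) (G : kind -> 'I_n.-1 -> A) :
    phi 1 = 1 -> {morph phi : u v / u + v} -> {morph phi : u v / u * v} ->
    (forall c, {morph phi : u / c *: u}) ->
    (forall u v, tBMW_rel x z a (G kG) (G kGinv) (G kH) (G kE) (G kF) u v ->
      phi u = phi v) ->
  forall u v, tBMW_rel x z a (phi \o G kG) (phi \o G kGinv) (phi \o G kH)
    (phi \o G kE) (phi \o G kF) u v -> u = v.
Proof.
move=> phi1 phiD phiM phiZ phi_rel u v.
by case=> * /=; rewrite -?phiM -?phiD -?phiZ -?phiM -?phi1; apply: phi_rel; constructor.
Qed.

(** * The presented algebra *)

(** Every element is a linear combination of monomials, and monomials grow from 1 by left
    multiplication by generators. *)
Lemma presented_ind (K : fieldType) (T : choiceType)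
    (rels : {malg K[word T]} -> {malg K[word T]} -> Prop)
    (Q : presented rels -> Prop) :
    Q 0 -> Q 1 -> (forall c p, Q p -> Q (c *: p)) ->
    (forall p q, Q p -> Q q -> Q (p + q)) ->
    (forall t p, Q p -> Q (pres_pi rels (free_gen K t) * p)) ->
  forall p, Q p.
Proof.
move=> Q0 Q1 QZ QD QM; apply: pres_piW => u; rewrite [u]monalgE.
apply: (big_ind (fun v => Q (pres_pi rels v))) => [|v w Qv Qw|w _].
- by rewrite pres_pi0.
- by rewrite pres_piD; apply: QD.
have -> c : mkmalgU w c = c *: mkmalgU w 1 :> {malg K[word T]}.
  by rewrite -mul_malgC malgM_def fgmulUU monalg.mul1m mulr1.
rewrite pres_piZ; apply: QZ.
elim: (w : seq T) => [//|t v Qv].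
have -> : mkmalgU (t :: v : word T) 1 = free_gen K t * mkmalgU (v : word T) 1.
  by rewrite malgM_def fgmulUU mulr1.
by rewrite pres_piM; apply: QM.
Qed.

Lemma tofracX_neq0 (F : fieldType) (m : nat) (i : 'I_m) :
  tofrac ('X_i : mpoly m F) != 0.
Proof.
rewrite tofrac_eq0; apply/eqP => /(congr1 (mpoly.mcoeff U_(i)%MM)) /eqP.
by rewrite mpoly.mcoeffX mpoly.mcoeff0 eqxx oner_eq0.
Qed.

Lemma tBMW_rel_gen (R : realType) (n : nat) (u v : tBMW R n) :
  tBMW_rel (Kx R) (Kz R) (Ka R) (gen R kG) (gen R kGinv) (gen R kH) (gen R kE)
    (gen R kF) u v -> u = v.
Proof.
apply: (@tBMW_rel_map (Kxza R) (Kx R) (Kz R) (Ka R) n {malg (Kxza R)[word (letter n)]}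
  (tBMW R n) (pres_pi _) (@letterg (Kxza R) n)).
- by [].
- exact: pres_piD.
- exact: pres_piM.
- exact: pres_piZ.
by move=> u' v' uv; apply/pres_piP/rel_ideal_gen.
Qed.

Theorem proposition2 (R : realType) (n : nat) (hn : (2 <= n)%N) :
  (forall u : tBMW R n, reduced u) /\ finite_dimensional (tBMW R n).
Proof.
have z0 : Kz R != 0 := tofracX_neq0 _ _.
have a0 : Ka R != 0 := tofracX_neq0 _ _.
have all_subalg (u : tBMW R n) : subalg (gen R (n := n)) n.-1 u.
  apply: presented_ind u => [||c p|p q|[k i] p].
  - exact: lin_span0.
  - by apply: lin_span_gen; exists [::]; rewrite ?evalw_nil.
  - exact: lin_spanZ.
  - exact: lin_spanD.
  exact: (subalg_mul_gen (@tBMW_rel_gen R n)).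
split=> [u|]; last first.
  have [s s_span] := subalg_finite z0 a0 (@tBMW_rel_gen R n) (leqnn n.-1).
  by apply: (finite_dimensional_span (s := s)) => u; apply: s_span.
(* The value [n - 2] is the last one in ['I_n.-1]; it encodes the generator index n - 1. *)
have lt_i : (n - 2 < n.-1)%N by rewrite -subn1 ltn_sub2l.
pose i := Ordinal lt_i.
have n1 : i.+1 = n.-1 by rewrite /= -subSn // subSS subn1.
apply: lin_span_sum.
have := all_subalg u; rewrite -n1 => /(subalg_ltS z0 a0 (@tBMW_rel_gen R n) erefl).
apply: lin_span_sub => _ [d [w1 [w2 [dG b1 b2 ->]]]].
(* With [i] of value [n - 2], [below i] is [low_word] by conversion: [l.2 < n - 2] means
   [l.2.+1 <= n - 2]. *)
by apply: lin_span_gen; exists i, d, w1, w2.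
Qed.
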